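(* Fix an OFDM frame $\mathbf{S}=[S_{\ell,m}]\in\mathbb{C}^{N\times M}$ with pilot subcarrier set $\bm{\mathcal{K}}_{p}\subseteq\mathbb{Z}_N$. Let $\bar{\mathbf{S}}=[\bar S_{\ell,m}]\in\mathbb{C}^{N\times M}$ be a frame obtained by adjusting only the phases of the pilot symbols, i.e., for arbitrary real $\theta_{\ell,m}$, $$\bar S_{\ell,m}=e^{j\theta_{\ell,m}}S_{\ell,m}\ \text{ for } \ell\in\bm{\mathcal{K}}_{p},\qquad \bar S_{\ell,m}=S_{\ell,m}\ \text{ for } \ell\in\mathbb{Z}_N\setminus\bm{\mathcal{K}}_{p},\qquad m\in\mathbb{Z}_M.$$ Then the P-ACF sidelobes are unchanged: writing $r_{\mathrm{P},m},\Gamma_{\mathrm{P}}$ and $\bar r_{\mathrm{P},m},\bar\Gamma_{\mathrm{P}}$ for the periodic autocorrelation functions and periodic self-ambiguity functions of the frames $\mathbf{S}$ and $\bar{\mathbf{S}}$, respectively, one has $\bar r_{\mathrm{P},m}[k]=r_{\mathrm{P},m}[k]$ for all $m\in\mathbb{Z}_M$ and all $k\in\mathbb{Z}_N\setminus\{0\}$, and $\bar\Gamma_{\mathrm{P}}[k,q]=\Gamma_{\mathrm{P}}[k,q]$ for all $(k,q)\in(\mathbb{Z}_N\times\mathbb{Z}_M^{\mathrm{c}})\setminus\{(0,0)\}$.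
   Context: Notation: $j=\sqrt{-1}$; for a positive integer $Q$, $\mathbb{Z}_Q=\{0,\ldots,Q-1\}$ and $a\bmod Q\in\mathbb{Z}_Q$ is the nonnegative remainder; $\mathbb{Z}_M^{\mathrm{c}}=\{-\lfloor M/2\rfloor,\ldots,\lceil M/2\rceil-1\}$. OFDM frame: $N$ subcarriers and $M$ OFDM symbols. The subcarrier index set $\mathbb{Z}_N$ is partitioned into disjoint sets $\bm{\mathcal{K}}_{d}$ (data), $\bm{\mathcal{K}}_{p}$ (pilot) and $\bm{\mathcal{K}}_{0}$ (null). The frame $\mathbf{S}\in\mathbb{C}^{N\times M}$ has entries $S_{\ell,m}$ equal to a data symbol if $\ell\in\bm{\mathcal{K}}_{d}$, a pilot symbol if $\ell\in\bm{\mathcal{K}}_{p}$, and $0$ if $\ell\in\bm{\mathcal{K}}_{0}$. Its $m$-th column is denoted $\mathbf{s}_m$. Modulation: $\mathbf{F}_N$ is the normalized DFT matrix, $[\mathbf{F}_N]_{a,b}=N^{-1/2}e^{-j2\pi ab/N}$ for $a,b\in\mathbb{Z}_N$. The $m$-th time-domain symbol is $\mathbf{x}_m=\mathbf{F}_N^{H}\mathbf{s}_m$, with samples $x_{n,m}=[\mathbf{x}_m]_n$, $n\in\mathbb{Z}_N$. Periodic autocorrelation function (P-ACF) of the $m$-th symbol: $r_{\mathrm{P},m}[k]=\sum_{n=0}^{N-1}x_{n,m}^{*}\,x_{(n+k)\bmod N,\,m}$, $k\in\mathbb{Z}_N$. Periodic self-ambiguity function: $\Gamma_{\mathrm{P}}[k,q]=\sum_{m=0}^{M-1}r_{\mathrm{P},m}[k]\,e^{-j2\pi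 qm/M}$, $(k,q)\in\mathbb{Z}_N\times\mathbb{Z}_M^{\mathrm{c}}$. Sidelobes are the values away from the mainlobe ($k=0$ for the per-symbol P-ACF, $(k,q)=(0,0)$ for the self-ambiguity function). *)

(* Defs.v *)
From mathcomp Require Import all_boot all_order all_algebra.
From mathcomp Require Import complex.
From mathcomp Require Import reals trigo.

Set Implicit Arguments.
Unset Strict Implicit.
Unset Printing Implicit Defensive.

Import Order.TTheory GRing.Theory Num.Theory.

Local Open Scope ring_scope.
Local Open Scope sesquilinear_scope.

Section Ofdm.
Variable R : realType.
Local Notation C := (R[i]).

(* e^{j t} for a real t. *)
Definition expj (t : R) : C := (cos t +i* sin t)%C.

Section Frame.
Variables N M : nat.

(* A set of subcarriers may be empty, which rules out [finset.partition]. *)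
Definition subcarrier_partition (Kd Kp K0 : {set 'I_N}) : Prop :=
  [/\ Kd :|: Kp :|: K0 = [set: 'I_N],
      [disjoint Kd & Kp], [disjoint Kd & K0] & [disjoint Kp & K0]].

(* Data and pilot symbols range over all of C, so that only the null
   subcarriers constrain the entries. *)
Definition is_ofdm_frame (Kd Kp K0 : {set 'I_N}) (S : 'M[C]_(N, M)) : Prop :=
  subcarrier_partition Kd Kp K0 /\ (forall l m, l \in K0 -> S l m = 0).

Definition dft : 'M[C]_N :=
  \matrix_(a, b) (((Num.sqrt N%:R)^-1)%:C%C
                  * expj (- (2 * pi * (a%:R * b%:R) / N%:R))).

Definition time_symbol (S : 'M[C]_(N, M)) (m : 'I_M) : 'cV[C]_N :=
  dft^t* *m col m S.

Lemma ltn_addmod (n k : 'I_N) : ((n + k) %% N < N)%N.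
Proof. by rewrite ltn_mod (leq_ltn_trans _ (ltn_ord n)). Qed.

Definition addmod (n k : 'I_N) : 'I_N := Ordinal (ltn_addmod n k).

Definition pacf (S : 'M[C]_(N, M)) (m : 'I_M) (k : 'I_N) : C :=
  \sum_(n < N) (time_symbol S m n 0)^* * time_symbol S m (addmod n k) 0.

(* Meaningful for q in [centered_range M]; q is a signed integer. *)
Definition self_ambiguity (S : 'M[C]_(N, M)) (k : 'I_N) (q : int) : C :=
  \sum_(m < M) pacf S m k * expj (- (2 * pi * (q%:~R * m%:R) / M%:R)).

End Frame.
End Ofdm.

(* {- floor(M/2), ..., ceil(M/2) - 1} *)
Definition centered_range (M : nat) : {pred int} :=
  [pred q : int | - (M./2)%:Z <= q <= (uphalf M)%:Z - 1].

(* Main.v *)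
(* The samples of the [m]-th symbol are the inverse DFT of its spectrum, so by
   orthogonality of the characters of Z/N the periodic autocorrelation is the
   Fourier transform of the power spectrum [`|S l m| ^+ 2] (Wiener-Khinchin),
   which forgets all phases. *)
Require Import Defs.
From mathcomp Require Import all_boot all_order all_algebra.
From mathcomp Require Import complex.
From mathcomp Require Import reals trigo.
From mathcomp Require Import ring lra.

Import Order.TTheory GRing.Theory Num.Theory.

Local Open Scope ring_scope.

Lemma expj0 (R : realType) : expj (0 : R) = 1.
Proof. by rewrite /expj cos0 sin0. Qed.

Lemma expjD (R : realType) (s t : R) : expj (s + t) = expj s * expj t.
Proof.
by rewrite /expj cosD sinD; apply/eqP; rewrite eq_complex /= addrC eqxx addrC !eqxx.
Qed.

Lemma expjMn (R : realType) (t : R) (n : nat) : expj (t *+ n) = expj t ^+ n.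
Proof. by elim: n => [|n IHn]; rewrite ?expj0 // mulrS exprS expjD IHn. Qed.

Lemma conj_expj (R : realType) (t : R) : (expj t)^* = expj (- t).
Proof. by rewrite /expj cosN sinN. Qed.

Lemma norm_expj (R : realType) (t : R) : `|expj t| = 1.
Proof. by rewrite normc_def /= cos2Dsin2 sqrtr1. Qed.

(** Half-angle formula: [cos t] is 1 minus twice the square of [sin (t / 2)], and this sine is
    positive because [t / 2] lies strictly between 0 and [pi]. *)
Lemma expj_neq1 (R : realType) (t : R) : 0 < t < 2 * pi -> expj t != 1.
Proof.
move=> /andP[t_gt0 t_lt]; apply/negP => /eqP[cost1 _].
have s_gt0 : 0 < sin (t / 2) by apply: sin_gt0_pi; rewrite ?divr_gt0 //; lra.
have := cosD (t / 2) (t / 2); rewrite -splitr cost1.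
by have := cos2Dsin2 (t / 2); nra.
Qed.

Lemma expj_prim_root (R : realType) (N : nat) :
  (0 < N)%N -> N.-primitive_root (expj (2 * pi / N%:R : R)).
Proof.
move=> N_gt0; have N_neq0 : N%:R != 0 :> R by rewrite pnatr_eq0 -lt0n.
have pi0 := pi_gt0 R.
have powE d : expj (2 * pi / N%:R : R) ^+ d = expj (2 * pi * (d%:R / N%:R)).
  by rewrite -expjMn -[_ *+ d]mulr_natr mulrAC mulrA.
(* The exponent [i.+1 = N] makes a full turn; a smaller one leaves an angle strictly between 0 and
   [2 * pi]. *)
rewrite /primitive_root_of_unity N_gt0; apply/forallP => i.
rewrite unity_rootE powE; have [->|neq_iN] := eqVneq i.+1 N.
  by rewrite divff // mulr1 mulr_natl /expj cos2pi sin2pi eqxx.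
rewrite eqbF_neg; apply: expj_neq1.
have lt_iN : (i.+1 < N)%N by rewrite ltn_neqAle neq_iN /=.
rewrite pmulr_rgt0 ?divr_gt0 ?ltr0n // ?mulr_gt0 //=.
by rewrite gtr_pMr ?mulr_gt0 // ltr_pdivrMr ?ltr0n // mul1r ltr_nat.
Qed.

(** Orthogonality of characters: off the diagonal this is a geometric sum whose ratio is an [N]-th
    root of unity other than 1. *)
Lemma sum_prim_root (F : fieldType) (N : nat) (w : F) (l l' : 'I_N) :
  N.-primitive_root w ->
  \sum_(n < N) (w ^+ l' / w ^+ l) ^+ n = N%:R *+ (l == l').
Proof.
move=> w_prim; have w_neq0 : w != 0.
  by rewrite (prim_root_eq0 w_prim) -lt0n (prim_order_gt0 w_prim).
have [<-|neq_l] := eqVneq l l'.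
  under eq_bigr do rewrite divff ?expf_neq0 // expr1n.
  by rewrite sumr_const card_ord.
set z := _ / _.
(* A ratio equal to 1 would make [l] and [l'] congruent modulo [N], hence equal, both being below
   [N]. *)
have z_neq1 : z - 1 != 0.
  rewrite subr_eq0; apply: contra neq_l => /eqP z1.
  apply/eqP/esym/val_inj/eqP; have := eq_prim_root_expr w_prim l' l.
  rewrite !modn_small // => /= <-.
  by rewrite -[w ^+ l' ](divfK (expf_neq0 l w_neq0)) -/z z1 mul1r.
apply: (mulfI z_neq1); rewrite -subrX1 mulr0 /z expr_div_n -!exprM.
by rewrite !(mulnC _ N) !exprM (prim_expr_order w_prim) !expr1n divr1 subrr.
Qed.

(** Conjugation flips the sign of the DFT exponent, so that only powers of a single primitive root
    remain. *)
Lemma time_symbolE (R : realType) (N M : nat) (S : 'M[R[i]]_(N, M))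
    (m : 'I_M) (n : 'I_N) :
  time_symbol S m n 0 =
  ((Num.sqrt N%:R)^-1)%:C%C *
  \sum_(l < N) expj (2 * pi / N%:R) ^+ (l * n) * S l m.
Proof.
rewrite /time_symbol mxE mulr_sumr; apply: eq_bigr => l _.
rewrite !mxE rmorphM /= conj_expj opprK -mulrA; congr (_ * (_ * _)).
  exact: conjc_real.
by rewrite -expjMn -[_ *+ (l * n)]mulr_natr natrM mulrAC.
Qed.

Lemma pacf_power_spectrum (R : realType) (N M : nat) (S : 'M[R[i]]_(N, M))
    (m : 'I_M) (k : 'I_N) :
  pacf S m k = \sum_(l < N) `|S l m| ^+ 2 * expj (2 * pi / N%:R) ^+ (l * k).
Proof.
have N_gt0 : (0 < N)%N by apply: leq_ltn_trans (ltn_ord k).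
have w_prim := expj_prim_root R N N_gt0.
set w := expj _ in w_prim *; set c : R[i] := ((Num.sqrt N%:R)^-1)%:C%C.
have conjw : w^* = w^-1.
  have := norm_expj R (2 * pi / N%:R); rewrite -/w => w1.
  by rewrite invC_norm w1 expr1n invr1 mul1r.
(* The two DFT normalizations cancel the factor [N] produced by orthogonality. *)
have cN : c^* * c * N%:R = 1.
  have -> : c^* = c by exact: conjc_real.
  rewrite -rmorphM /= -expr2 exprVn sqr_sqrtr ?ler0n //.
  by rewrite -(rmorph_nat (real_complex R)) -rmorphM /= mulVf // pnatr_eq0 -lt0n.
(* The dependence on [n] is isolated in one [n]-th power, ready for the character sum. *)
have termE n : (time_symbol S m n 0)^* * time_symbol S m (addmod n k) 0 =
    \sum_(l < N) \sum_(l' < N) c^* * c * ((S l m)^* * S l' m * w ^+ (l' * k) *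
                              (w ^+ l' / w ^+ l) ^+ n).
  rewrite !time_symbolE -/w -/c rmorphM mulrACA rmorph_sum mulr_suml mulr_sumr.
  apply: eq_bigr => l _; rewrite !mulr_sumr; apply: eq_bigr => l' _.
  congr (_ * _); rewrite rmorphM rmorphXn /= conjw.
  (* The cyclic wrap-around is invisible to [w], whose [N]-th power is 1. *)
  have -> : w ^+ (l' * ((n + k) %% N)) = w ^+ (l' * n) * w ^+ (l' * k).
    by rewrite -(prim_expr_mod w_prim) modnMmr (prim_expr_mod w_prim) mulnDr exprD.
  rewrite expr_div_n -!exprM exprVn; ring.
rewrite /pacf; under eq_bigr do rewrite termE.
rewrite exchange_big; apply: eq_bigr => l _ /=.
(* With the sum over [n] innermost, only [l' = l] survives, and the conjugate product there is the
   squared modulus. *)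
rewrite exchange_big (bigD1 l) //= [X in _ + X]big1 ?addr0 => [|l' neq_l].
  rewrite -!mulr_sumr sum_prim_root // eqxx mulr1n mulrCA mulrA.
  by rewrite -mulrA cN mulr1 normCKC.
by rewrite -!mulr_sumr sum_prim_root // eq_sym (negbTE neq_l) !mulr0.
Qed.

Theorem lemma2 (R : realType) (N M : nat) (hN : (0 < N)%N) (hM : (0 < M)%N)
    (Kd Kp K0 : {set 'I_N}) (S Sbar : 'M[R[i]]_(N, M))
    (theta : 'I_N -> 'I_M -> R)
    (hS : is_ofdm_frame Kd Kp K0 S)
    (hpilot : forall (l : 'I_N) (m : 'I_M),
        l \in Kp -> Sbar l m = expj (theta l m) * S l m)
    (hother : forall (l : 'I_N) (m : 'I_M),
        l \notin Kp -> Sbar l m = S l m) :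
  (forall (m : 'I_M) (k : 'I_N), (k : nat) <> 0%N ->
     pacf Sbar m k = pacf S m k) /\
  (forall (k : 'I_N) (q : int), q \in centered_range M ->
     ((k : nat), q) <> (0%N, 0) ->
     self_ambiguity Sbar k q = self_ambiguity S k q).
Proof.
have norm_eq l m : `|Sbar l m| = `|S l m|.
  have [/hpilot->|/hother->//] := boolP (l \in Kp).
  by rewrite normrM norm_expj mul1r.
have pacf_eq m k : pacf Sbar m k = pacf S m k.
  by rewrite !pacf_power_spectrum; under eq_bigr do rewrite norm_eq.
by split=> [m k _|k q _ _] //; apply: eq_bigr => m _; rewrite pacf_eq.
Qed.
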